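(* Let $\mathcal U$ be a quasi-definite vector of linear functionals, $\{G_m\}_{m\in\mathbb N}$ a sequence of matrix polynomials with $N\times N$ matrix coefficients, $\{G^{(1)}_m\}_{m\in\mathbb N}$ its sequence of associated polynomials of the first kind (for $\mathcal U$), and $\mathcal F$ the generalized Markov matrix function of $\mathcal U$. Then $\{G_m\}_{m\in\mathbb N}$ is right-orthogonal with respect to $\mathcal U$ if and only if, for every $m\in\mathbb N$, $$\mathcal F(z)G_{m+1}(z)-G^{(1)}_m(z)=\Theta_{m+1}\frac1{z^{m+2}}+\cdots,$$ where $\Theta_{m+1}$ is a non-singular lower triangular matrix and the dots denote a series in the powers $z^{-n}$, $n\ge m+3$.
   Context: $N\ge1$ is a fixed integer, $\mathbb N=\{0,1,2,\dots\}$, $h$ is a fixed polynomial of degree $N$, $\mathbb P$ is the space of polynomials, $\mathbb P^N$ the space of column vectors of $N$ polynomials. $\mathcal P_0(x)=[1\;x\;\cdots\;x^{N-1}]^T$ and $\mathcal P_j(x)=h(x)^j\mathcal P_0(x)$. A vector of linear functionals is $\mathcal U=[u^1\cdots u^N]^T$ with $u^j:\mathbb P\to\mathbb R$ linear; it acts on $\mathcal P=[p_1\cdots p_N]^T\in\mathbb P^N$ by the matrix $\mathcal U(\mathcal P)$ whose $(i,j)$ entry is $\langle u^j,p_i\rangle$ ($\mathcal U_x$ indicates action on the variable $x$), and $(h^k\mathcal U)(\mathcal P):=\mathcal U(h^k\mathcal P)$. For a matrix polynomial $G(z)=\sum_k\beta_kz^k$, the vector of functionals $G^T(h(x))\,\mathcal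 U$ acts by $\big(G^T(h(x))\,\mathcal U\big)(\mathcal P)=\sum_k(h^k\mathcal U)(\mathcal P)\,\beta_k$. $\mathcal U$ is quasi-definite if all leading principal submatrices of the block Hankel matrices $[\mathcal U(\mathcal P_{i+j})]_{i,j=0}^m$, $m\in\mathbb N$, are non-singular. $\{G_m\}$ is right-orthogonal with respect to $\mathcal U$ if, for all $m\in\mathbb N$: $\deg G_m=m$; $(G_m^T(h(x))\,\mathcal U)(\mathcal P_j)=0_{N\times N}$ for $j=0,\dots,m-1$; and $(G_m^T(h(x))\,\mathcal U)(\mathcal P_m)=\Theta_m$ is a non-singular lower triangular matrix. The associated polynomials of the first kind for $\{G_m\}$ and $\mathcal U$ are $$G^{(1)}_m(z)=\left[\left(\frac{G_{m+1}^T(z)-G_{m+1}^T(h(x))}{z-h(x)}\right)\mathcal U_x\right](\mathcal P_0(x));$$ explicitly, if $G_{m+1}(z)=\sum_k\beta_kz^k$, then $G_m^{(1)}(z)=\sum_{k\ge1}\sum_{b=0}^{k-1}z^{k-1-b}\,\mathcal U(\mathcal P_b)\,\beta_k$. The generalized Markov matrix function is $\mathcal F(z)=\mathcal U_x\big(\mathcal P_0(x)/(z-h(x))\big)$, for $z$ with $|h(x)|<|z|$ for every $x\in\bigcup_{j}\operatorname{supp}u^j$, the action of $\mathcal U$ being understood through the expansion $\mathcal F(z)=\sum_{n=0}^\infty\mathcal U(h^n\mathcal P_0)\,z^{-n-1}$.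
   Formalization: The ''if'' direction needs, and the formal theorem assumes, deg G_m ≤ m for all m and that U(P_0)G_0 is a non-singular lower triangular matrix; otherwise replacing G_0 by 0, or G_1 by G_1+G_2, leaves the form of every expansion intact but destroys right-orthogonality. *)

(* Defs.v *)
From HB Require Import structures.
From mathcomp Require Import all_boot all_order all_algebra.
From mathcomp Require Import reals.

Set Implicit Arguments.
Unset Strict Implicit.
Unset Printing Implicit Defensive.

Import Order.TTheory GRing.Theory Num.Theory.
Local Open Scope ring_scope.

(* The dimension N >= 1 is written n.+1, so that N x N matrices form a
   nontrivial ring and {poly 'M[R]_n.+1} is the type of matrix polynomials. *)

Section VectorFunctionals.

Variables (R : realType) (n : nat).
Implicit Types (h : {poly R}) (U : 'I_n.+1 -> {scalar {poly R}}).
Implicit Types (P : 'cV[{poly R}]_n.+1) (G : {poly 'M[R]_n.+1}).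

Definition vfun_app U P : 'M[R]_n.+1 := \matrix_(i, j) U j (P i 0).

Definition vpoly h (j : nat) : 'cV[{poly R}]_n.+1 :=
  h ^+ j *: \col_(i < n.+1) 'X^i.

(* (h^k U)(P) *)
Definition vfun_mulh h (k : nat) U P : 'M[R]_n.+1 := vfun_app U (h ^+ k *: P).

(* (G^T(h(x)) U)(P); the coefficients of G act on the right. *)
Definition vfun_mulG h G U P : 'M[R]_n.+1 :=
  \sum_(k < size G) vfun_mulh h k U P *m G`_k.

Definition block_hankel h U (m : nat) :=
  \mxblock_(i < m.+1, j < m.+1) vfun_app U (vpoly h (i + j)).

(* Leading principal submatrices of every order k are considered, not only
   those whose order is a multiple of n.+1. *)
Definition quasi_definite h U : Prop :=
  forall (m k : nat) (le_k : (k <= \sum_(i < m.+1) n.+1)%N),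
    mxsub (widen_ord le_k) (widen_ord le_k) (block_hankel h U m) \in unitmx.

(* is_trig_mx is lower triangularity: A i j = 0 whenever i < j. *)
Definition nonsing_lower (A : 'M[R]_n.+1) : Prop :=
  (A \in unitmx) /\ is_trig_mx A.

Definition right_orthogonal h U (G : nat -> {poly 'M[R]_n.+1}) : Prop :=
  forall m : nat,
    [/\ size (G m) = m.+1,
        forall j : nat, (j < m)%N -> vfun_mulG h (G m) U (vpoly h j) = 0
      & nonsing_lower (vfun_mulG h (G m) U (vpoly h m))].

(* U_x applied to P_0(x) through the divided difference
   (G(z) - G(h(x))) / (z - h(x))
     = \sum_k \sum_(b < k) z^(k-1-b) h(x)^b G`_k. *)
Definition assoc_first h U G : {poly 'M[R]_n.+1} :=
  \sum_(k < size G) \sum_(b < k)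
     (vfun_app U (vpoly h b) *m G`_k) *: 'X^(k.-1 - b).

(* A formal Laurent series in z^-1 is represented by its coefficients: the
   value at k : int is the coefficient of z^k, zero for all large enough k. *)
Definition mx_laurent := int -> 'M[R]_n.+1.

(* Negz i stands for the exponent - i.+1. *)
Definition markov h U : mx_laurent := fun k =>
  if k is Negz i then vfun_app U (vpoly h i) else 0.

Definition laurent_of_poly G : mx_laurent := fun k =>
  if k is Posz i then G`_i else 0.

Definition laurent_mulp (S : mx_laurent) G : mx_laurent := fun k =>
  \sum_(i < size G) S (k - i%:Z) *m G`_i.

Definition markov_remainder h U (G : nat -> {poly 'M[R]_n.+1}) (m : nat)
    : mx_laurent := fun k =>
  laurent_mulp (markov h U) (G m.+1) k
    - laurent_of_poly (assoc_first h U (G m.+1)) k.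

(* S = Theta z^-d + (terms in z^-i, i > d) *)
Definition laurent_leading (S : mx_laurent) (d : nat) (Theta : 'M[R]_n.+1)
    : Prop :=
  S (- d%:Z) = Theta /\ forall k : int, - d%:Z < k -> S k = 0.

End VectorFunctionals.

Arguments vpoly {R n} h j.

(* Main.v *)
Require Import Defs.
From HB Require Import structures.
From mathcomp Require Import all_boot all_order all_algebra.
From mathcomp Require Import reals.
From mathcomp Require Import zify.

Import Order.TTheory GRing.Theory Num.Theory.
Local Open Scope ring_scope.

(** Multiplying the Markov series by a matrix polynomial [G] gives a Laurent
    series whose two halves can be read off coefficient by coefficient.  The
    coefficient of [z^-(i+1)] is [\sum_k U(P_(i+k)) *m G`_k], which is the
    moment [(G^T(h) U)(P_i)] ([laurent_mulp_markov_neg]); the polynomial part is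
    exactly the associated polynomial of the first kind
    ([laurent_mulp_markov_pos]).  So the remainder for [G_(m+1)] is the
    generating series of the moments [(G_(m+1)^T(h) U)(P_i)], and saying that it
    starts with [Theta z^-(m+2)] is saying that the moments with [i <= m] vanish
    and that the moment with [i = m+1] is [Theta].

    These are the orthogonality conditions except for the exact degree of
    [G_(m+1)], which the expansion mentions nowhere.  Quasi-definiteness supplies
    it: if the degree dropped, the coefficients of [G_(m+1)] would form a block
    column killed by a nonsingular block Hankel matrix, hence [G_(m+1) = 0]
    ([orthogonal_eq0]), against the nonsingularity of [Theta]. *)

Section MarkovRemainder.

Context (R : realType) (n : nat) (h : {poly R}).
Context (U : 'I_n.+1 -> {scalar {poly R}}).
Implicit Types G : {poly 'M[R]_n.+1}.

Lemma vfun_mulh_vpoly (j k : nat) :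
  vfun_mulh h k U (vpoly h j) = vfun_app U (vpoly h (j + k)).
Proof. by rewrite /vfun_mulh /vpoly scalerA -exprD addnC. Qed.

(** The summation bound is left free so that it can be matched with the number
    of block columns of a Hankel matrix, whatever the actual degree of [G]. *)
Lemma vfun_mulG_vpoly G (j M : nat) :
  (size G <= M)%N ->
  vfun_mulG h G U (vpoly h j)
    = \sum_(k < M) vfun_app U (vpoly h (j + k)) *m G`_k.
Proof.
move=> leGM; rewrite /vfun_mulG.
rewrite (big_ord_widen M (fun k => vfun_mulh h k U (vpoly h j) *m G`_k) leGM).
rewrite big_mkcond; apply: eq_bigr => k _; rewrite vfun_mulh_vpoly.
by case: ltnP => // leGk; rewrite nth_default // mulmx0.
Qed.

Lemma laurent_mulp_markov_neg G (i : nat) :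
  laurent_mulp (markov h U) G (Negz i) = vfun_mulG h G U (vpoly h i).
Proof.
rewrite (vfun_mulG_vpoly _ _ _ (leqnn _)); apply: eq_bigr => k _.
by have -> : Negz i - k%:Z = Negz (i + k) by lia.
Qed.

(** Both sides collect [U(P_b) *m G`_k] over the pairs with [b = k - 1 - i]: the
    divided difference is built to be the polynomial part of the product. *)
Lemma laurent_mulp_markov_pos G (i : nat) :
  laurent_mulp (markov h U) G (Posz i) = (assoc_first h U G)`_i.
Proof.
rewrite /assoc_first coef_sum; apply: eq_bigr => k _; rewrite coef_sum.
have [leki | ltik] := leqP k i.
  rewrite subzn // mul0mx big1 // => b _; have ltbk := ltn_ord b.
  by rewrite coefZ coefXn (_ : _ == _ = false) ?mulr0 //; lia.
have [ltb leik] : (k.-1 - i < k)%N /\ (i <= k.-1)%N by split; lia.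
rewrite (bigD1 (Ordinal ltb)) //= big1 ?addr0 => [|b neb].
  have -> : Posz i - k%:Z = Negz (k.-1 - i) by lia.
  by rewrite coefZ coefXn subKn // eqxx mulr1.
rewrite coefZ coefXn; case: eqP => [e | _]; last by rewrite mulr0.
case/eqP: neb; apply: val_inj; rewrite /= e subKn //.
by rewrite -ltnS prednK // (leq_ltn_trans _ ltik).
Qed.

Lemma markov_remainder_neg (G : nat -> {poly 'M[R]_n.+1}) (m i : nat) :
  markov_remainder h U G m (Negz i) = vfun_mulG h (G m.+1) U (vpoly h i).
Proof. by rewrite /markov_remainder laurent_mulp_markov_neg subr0. Qed.

Lemma markov_remainder_pos (G : nat -> {poly 'M[R]_n.+1}) (m i : nat) :
  markov_remainder h U G m (Posz i) = 0.
Proof. by rewrite /markov_remainder laurent_mulp_markov_pos subrr. Qed.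

Lemma block_hankel_unit (m : nat) :
  quasi_definite h U -> block_hankel h U m \in unitmx.
Proof.
move=> /(_ m _ (leqnn _)); congr (_ \in unitmx).
apply/matrixP => i j; rewrite mxE.
by congr (block_hankel h U m _ _); apply: val_inj.
Qed.

(** The moments of [G] against [P_0, ..., P_m] are the blocks of the product of
    the block Hankel matrix of order [m] by the column of coefficients of [G]. *)
Lemma orthogonal_eq0 G (m : nat) :
  quasi_definite h U -> (size G <= m.+1)%N ->
  (forall j, (j <= m)%N -> vfun_mulG h G U (vpoly h j) = 0) -> G = 0.
Proof.
move=> qdU leGm orthG.
have HG0 : block_hankel h U m *m (\mxcol_(i < m.+1) G`_i) = 0.
  rewrite mul_mxblock_mxrow -[RHS](mxcol0 _); apply: eq_mxcol => i.
  by rewrite -(vfun_mulG_vpoly _ _ _ leGm) orthG // -ltnS.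
have /mxcolP G0 : \mxcol_(i < m.+1) G`_i = 0 :> 'M_(_, n.+1).
  by rewrite -[LHS](mulKmx (block_hankel_unit m qdU)) HG0 mulmx0.
apply/polyP => i; rewrite coef0.
have [leGi | ltiG] := leqP (size G) i; first by rewrite nth_default.
by have := G0 (Ordinal (leq_trans ltiG leGm)); rewrite mxcolK submxcol0.
Qed.

End MarkovRemainder.

Theorem theorem13 (R : realType) (n : nat) (h : {poly R})
    (U : 'I_n.+1 -> {scalar {poly R}}) (G : nat -> {poly 'M[R]_n.+1})
    (size_h : size h = n.+2)
    (qdU : quasi_definite h U)
    (size_G : forall m : nat, (size (G m) <= m.+1)%N)
    (G0 : nonsing_lower (vfun_mulG h (G 0%N) U (vpoly h 0))) :
  right_orthogonal h U G <->
  (forall m : nat, exists Theta : 'M[R]_n.+1,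
     nonsing_lower Theta /\
     laurent_leading (markov_remainder h U G m) m.+2 Theta).
Proof.
split=> [orthG m | lead].
  have [_ orth_lt nsl] := orthG m.+1.
  exists (vfun_mulG h (G m.+1) U (vpoly h m.+1)); split=> //.
  rewrite /laurent_leading -NegzE markov_remainder_neg; split=> //.
  move=> [i | i] lti; first by rewrite markov_remainder_pos.
  by rewrite markov_remainder_neg orth_lt //; lia.
have orth m j : (j < m)%N -> vfun_mulG h (G m) U (vpoly h j) = 0.
  case: m => // m ltjm; have [Theta [_ [_ lead0]]] := lead m.
  by rewrite -markov_remainder_neg lead0 //; lia.
have nsl m : nonsing_lower (vfun_mulG h (G m) U (vpoly h m)).
  case: m => // m; have [Theta [nslT [leadT _]]] := lead m.
  by rewrite -markov_remainder_neg NegzE leadT.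
move=> m; split=> //; last exact: orth.
apply/eqP; rewrite eqn_leq size_G leqNgt ltnS; apply/negP => leGm.
(* The Hankel argument needs at least one block; for m = 0 the degree bound
   alone makes G 0 vanish. *)
have Gm0 : G m = 0.
  case: m leGm => [|m] leGm; first by apply/eqP; rewrite -size_poly_leq0.
  by apply: (orthogonal_eq0 _ _ _ _ _ _ qdU leGm) => j lejm; apply: orth.
have [] := nsl m; rewrite Gm0 /vfun_mulG size_poly0 big_ord0.
by rewrite unitmxE det0 unitr0.
Qed.
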